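(* Let $R$ be a commutative noetherian ring, $C$ a semidualizing $R$-module, and $x,y\in R$. If $x,y$ form a pair of exact zero-divisors on both $R$ and $C$, then $R/xR\in\mathcal G_C(R)$.
   Context: Rings are commutative noetherian with identity; ''finite'' means finitely generated. A finite $R$-module $C$ is semidualizing if the natural homothety map $R\to\operatorname{Hom}_R(C,C)$ is an isomorphism and $\operatorname{Ext}^i_R(C,C)=0$ for all $i>0$. For an $R$-module $M$ and $x,y\in R$, one says that $x,y$ form a pair of exact zero-divisors on $M$ if $xM\neq 0$, $xM\neq M$ and the sequence of multiplication maps $M\xrightarrow{x}M\xrightarrow{y}M\xrightarrow{x}M$ is exact. $\mathcal G_C(R)$ is the class of $\mathrm G_C$-projective $R$-modules, i.e. all finite $R$-modules $M$ such that, writing $(-)^\dagger=\operatorname{Hom}_R(-,C)$: (i) the natural biduality map $M\to M^{\dagger\dagger}$ is an isomorphism; (ii) $\operatorname{Ext}^i_R(M,C)=0=\operatorname{Ext}^i_R(M^\dagger,C)$ for all $i>0$. *)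

(* Defs.v *)
(* MathComp with the classical axioms of [boolp]: every set of elements of a
   module is given by a boolean predicate, so [submodClosed M] ranges over all
   submodules of [M]. *)
From HB Require Import structures.
From mathcomp Require Import all_boot all_algebra ring_quotient generic_quotient.
From mathcomp Require Import finmap.
From mathcomp Require Import boolp classical_sets functions cardinality fsbigop.

Set Implicit Arguments.
Unset Strict Implicit.
Unset Printing Implicit Defensive.

Import GRing.Theory.
Local Open Scope classical_set_scope.
Local Open Scope ring_scope.
Local Open Scope quotient_scope.

Record submod (R : pzRingType) (M : lmodType R) (S : submodClosed M) : Type :=
  Submod { submod_val : M; submod_valP : submod_val \in S }.

HB.instance Definition _ (R : pzRingType) (M : lmodType R)
  (S : submodClosed M) := [isSub for @submod_val R M S].
HB.instance Definition _ (R : pzRingType) (M : lmodType R)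
  (S : submodClosed M) := [Choice of submod S by <:].
HB.instance Definition _ (R : pzRingType) (M : lmodType R)
  (S : submodClosed M) := [SubChoice_isSubLmodule of submod S by <:].

Section QuotientModule.
Variables (R : pzRingType) (M : lmodType R) (S : submodClosed M).

(* MathComp does not infer closure under opposite from [submodClosed]. *)
Definition submod_pred : {pred M} := fun m => m \in S.

Fact submod_pred_zmod : zmod_closed submod_pred.
Proof. exact: GRing.submod_closedB (submodClosedP S). Qed.

HB.instance Definition _ :=
  GRing.isZmodClosed.Build M submod_pred submod_pred_zmod.

(* [Quotient.quot] is the quotient of an additive group by a subgroup; the
   scaling by [R] is added here. *)
Definition quotmod : Type := Quotient.quot submod_pred.

HB.instance Definition _ := GRing.Zmodule.on quotmod.

Definition quotmod_pi (m : M) : quotmod := \pi_(Quotient.quot submod_pred) m.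
Definition quotmod_repr (q : quotmod) : M := repr (q : Quotient.quot submod_pred).
Definition quotmod_scale (a : R) (q : quotmod) : quotmod :=
  quotmod_pi (a *: quotmod_repr q).

Lemma quotmod_reprK : cancel quotmod_repr quotmod_pi.
Proof. by move=> q; exact: reprK. Qed.

Lemma quotmod_piP m n : quotmod_pi m = quotmod_pi n <-> m - n \in S.
Proof.
have := Quotient.idealrBE submod_pred m n; rewrite /quotmod_pi => ->.
by split=> [/eqP|/eqP].
Qed.

Lemma quotmod_piD m n : quotmod_pi (m + n) = quotmod_pi m + quotmod_pi n.
Proof. exact: (Quotient.pi_add submod_pred). Qed.

Lemma quotmod_scaleE a m : quotmod_scale a (quotmod_pi m) = quotmod_pi (a *: m).
Proof.
apply/quotmod_piP; rewrite -scalerBr rpredZ //.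
by apply/quotmod_piP; rewrite quotmod_reprK.
Qed.

Fact quotmod_scaleA a b q :
  quotmod_scale a (quotmod_scale b q) = quotmod_scale (a * b) q.
Proof.
by rewrite -[q]quotmod_reprK !quotmod_scaleE scalerA.
Qed.

Fact quotmod_scale1 : left_id 1 quotmod_scale.
Proof. by move=> q; rewrite -[q]quotmod_reprK quotmod_scaleE scale1r. Qed.

Fact quotmod_scaleDr : right_distributive quotmod_scale +%R.
Proof.
move=> a p q; rewrite -[p]quotmod_reprK -[q]quotmod_reprK.
by rewrite -quotmod_piD !quotmod_scaleE scalerDr quotmod_piD.
Qed.

Fact quotmod_scaleDl q : {morph quotmod_scale^~ q : a b / a + b}.
Proof.
move=> a b; rewrite -[q]quotmod_reprK.
by rewrite !quotmod_scaleE scalerDl quotmod_piD.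
Qed.

HB.instance Definition _ := GRing.Zmodule_isLmodule.Build R quotmod
  quotmod_scaleA quotmod_scale1 quotmod_scaleDr quotmod_scaleDl.

Fact quotmod_pi_is_linear : linear quotmod_pi.
Proof. by move=> a m n; rewrite quotmod_piD -quotmod_scaleE. Qed.

HB.instance Definition _ :=
  GRing.isLinear.Build R M quotmod *:%R quotmod_pi quotmod_pi_is_linear.

End QuotientModule.

Section KernelImage.
Variables (R : pzRingType) (M N : lmodType R) (f : {linear M -> N}).

Definition lin_ker : {pred M} := fun m => f m == 0.
Definition lin_im : {pred N} := fun n => `[< range f n >].
Definition lin_preim (S : submodClosed N) : {pred M} := fun m => f m \in S.

Fact lin_ker_submod : submod_closed lin_ker.
Proof.
split=> [|a u v]; rewrite !unfold_in ?linear0 // => /eqP fu /eqP fv.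
by rewrite linearP fu fv scaler0 addr0.
Qed.

Fact lin_im_submod : submod_closed lin_im.
Proof.
split=> [|a u v]; first by apply/asboolP; exists 0; rewrite ?linear0.
move=> /asboolP[m _ <-] /asboolP[n _ <-]; apply/asboolP.
by exists (a *: m + n); rewrite ?linearP.
Qed.

Fact lin_preim_submod S : submod_closed (lin_preim S).
Proof.
have inE m : (m \in lin_preim S) = (f m \in S) by [].
split=> [|a u v]; rewrite !inE ?linear0 ?rpred0 // => fu fv.
by rewrite linearP rpredD ?rpredZ.
Qed.

HB.instance Definition _ := GRing.isSubmodClosed.Build R M lin_ker lin_ker_submod.
HB.instance Definition _ := GRing.isSubmodClosed.Build R N lin_im lin_im_submod.
HB.instance Definition _ S :=
  GRing.isSubmodClosed.Build R M (lin_preim S) (lin_preim_submod S).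

End KernelImage.

(* The homology [ker g / im f] of [M -f-> N -g-> P], where [im f] is taken
   inside [ker g]. *)
Definition homology (R : pzRingType) (M N P : lmodType R)
    (f : {linear M -> N}) (g : {linear N -> P}) : lmodType R :=
  quotmod (lin_preim (\val : {linear submod (lin_ker g) -> N}) (lin_im f)).

Section Hom.
Variable R : comPzRingType.
Implicit Types M N P : lmodType R.

Definition is_hom M N : {pred M -> N} := fun f => `[< linear f >].

Fact is_hom_submod M N : submod_closed (@is_hom M N).
Proof.
split=> [|a f g /asboolP lf /asboolP lg]; apply/asboolP => b u v.
  by rewrite /= scaler0 addr0.
rewrite !fctE lf lg !scalerDr !scalerA (mulrC a b).
by rewrite addrACA.
Qed.

HB.instance Definition _ M N :=
  GRing.isSubmodClosed.Build R (M -> N) (@is_hom M N) (@is_hom_submod M N).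

Definition Hom M N : lmodType R := submod (@is_hom M N).

Definition hom_fun M N (h : Hom M N) : M -> N := submod_val h.

Fact hom_fun_is_linear M N (h : Hom M N) : linear (hom_fun h).
Proof. exact/asboolP/(submod_valP h). Qed.

HB.instance Definition _ M N (h : Hom M N) :=
  GRing.isLinear.Build R M N *:%R (hom_fun h) (hom_fun_is_linear h).

Fact is_hom_linear M N (f : {linear M -> N}) : (f : M -> N) \in @is_hom M N.
Proof. by apply/asboolP => a u v; rewrite linearP. Qed.

Definition hom_of M N (f : {linear M -> N}) : Hom M N :=
  Submod (is_hom_linear f).

Lemma hom_ofK M N (f : {linear M -> N}) : hom_fun (hom_of f) = f.
Proof. by []. Qed.

Lemma hom_ext M N (g h : Hom M N) : hom_fun g =1 hom_fun h -> g = h.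
Proof. by move=> gh; apply: val_inj; apply/funext. Qed.

Section HomPre.
Variables (M M' N : lmodType R) (f : {linear M -> M'}).

Definition Hom_pre (h : Hom M' N) : Hom M N := hom_of (hom_fun h \o f).

Fact Hom_pre_is_linear : linear Hom_pre.
Proof. by move=> a g h; apply: hom_ext. Qed.

HB.instance Definition _ :=
  GRing.isLinear.Build R (Hom M' N) (Hom M N) *:%R Hom_pre Hom_pre_is_linear.

End HomPre.

Arguments Hom_pre {M M'} N f h.

Section Homothety.
Variable M : lmodType R.

Definition homothety (r : R) : Hom M M := hom_of ( *:%R r : {linear M -> M}).

Fact homothety_is_linear : linear (homothety : R^o -> Hom M M).
Proof.
move=> a r s; apply: hom_ext => m.
by rewrite /hom_fun /= scalerDl -scalerA.
Qed.

HB.instance Definition _ :=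
  GRing.isLinear.Build R R^o (Hom M M) *:%R homothety homothety_is_linear.

End Homothety.

Section Biduality.
Variables M C : lmodType R.

Definition eval_at (m : M) (h : Hom M C) : C := hom_fun h m.

Fact eval_at_is_linear m : linear (eval_at m).
Proof. by []. Qed.

HB.instance Definition _ m :=
  GRing.isLinear.Build R (Hom M C) C *:%R (eval_at m) (eval_at_is_linear m).

Definition biduality (m : M) : Hom (Hom M C) C := hom_of (eval_at m).

Fact biduality_is_linear : linear biduality.
Proof. by move=> a m n; apply: hom_ext => h; rewrite /hom_fun /= /eval_at linearP. Qed.

HB.instance Definition _ :=
  GRing.isLinear.Build R M (Hom (Hom M C) C) *:%R biduality biduality_is_linear.

End Biduality.

(* The free module on [X]: finitely supported functions [X -> R]. *)
Section Free.
Variable X : Type.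

Definition fin_supp : {pred X -> R^o} :=
  fun c => `[< finite_set [set x | c x != 0] >].

Fact fin_supp_submod : submod_closed fin_supp.
Proof.
split=> [|a c d /asboolP fc /asboolP fd]; apply/asboolP.
  by rewrite (_ : [set _ | _] = set0) // -subset0 => x /=; rewrite eqxx.
apply: (@sub_finite_set _ _ ([set x | c x != 0] `|` [set x | d x != 0])).
  move=> x /=; apply: contraNP => /not_orP[/negP/negPn/eqP c0 /negP/negPn/eqP d0].
  by rewrite !fctE c0 d0 scaler0 addr0.
by rewrite finite_setU.
Qed.

HB.instance Definition _ :=
  GRing.isSubmodClosed.Build R (X -> R^o) fin_supp fin_supp_submod.

Definition free_mod : lmodType R := submod fin_supp.

Definition coef (c : free_mod) (x : X) : R := submod_val c x.

Lemma coef_fin (c : free_mod) : finite_set [set x | coef c x != 0].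
Proof. exact/asboolP/(submod_valP c). Qed.

Lemma coefP a (c d : free_mod) x : coef (a *: c + d) x = a * coef c x + coef d x.
Proof. by []. Qed.

End Free.

Section Augmentation.
Variable M : lmodType R.

Definition augment (c : free_mod M) : M :=
  \sum_(m \in [set: M]) coef c m *: m.

Lemma augmentE (A : set M) (c : free_mod M) : finite_set A ->
    [set m | coef c m != 0] `<=` A ->
  augment c = \sum_(m <- fset_set A) coef c m *: m.
Proof.
move=> finA cA; rewrite -fsbig_finite //; apply/esym/fsbig_widen => // m [_ Am].
rewrite /preimage /=; have [->|/cA //] := eqVneq (coef c m) 0.
by rewrite scale0r.
Qed.

Fact augment_is_linear : linear augment.
Proof.
move=> a c d.
pose A := [set m | coef c m != 0] `|` [set m | coef d m != 0].
have finA : finite_set A.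
  by rewrite finite_setU; split; exact: coef_fin.
have cA : [set m | coef c m != 0] `<=` A by move=> m /=; left.
have dA : [set m | coef d m != 0] `<=` A by move=> m /=; right.
have acdA : [set m | coef (a *: c + d) m != 0] `<=` A.
  move=> m; rewrite /mkset; apply: contraNP.
  move=> /not_orP[/negP/negPn/eqP c0 /negP/negPn/eqP d0].
  by rewrite coefP c0 d0 mulr0 addr0.
rewrite !(@augmentE A) //.
rewrite scaler_sumr -big_split; apply: eq_bigr => m _.
by rewrite coefP scalerDl scalerA.
Qed.

HB.instance Definition _ :=
  GRing.isLinear.Build R (free_mod M) M *:%R augment augment_is_linear.

Lemma augment_surj m : exists c, augment c = m.
Proof.
pose b : M -> R^o := fun n => if n == m then 1 else 0.
have b_fin : b \in @fin_supp M.
  apply/asboolP; apply: (sub_finite_set _ (finite_set1 m)) => n /=.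
  by rewrite /b; case: (eqVneq n m) => // _ /eqP.
exists (Submod b_fin); rewrite (@augmentE [set m]) //=.
  by rewrite fset_set1 big_seq_fset1 /coef /= /b eqxx scale1r.
by move=> n /=; rewrite /coef /= /b; case: (eqVneq n m) => // _ /eqP.
Qed.

End Augmentation.

(* The standard free resolution
     ... -> res_mod M 1 -> res_mod M 0 -> M -> 0,
   where [res_mod M n] is free on the elements of the [n]th syzygy of [M]. *)
Fixpoint syzygy M (n : nat) : lmodType R :=
  if n is n'.+1 then submod (lin_ker (@augment (syzygy M n'))) else M.

Definition res_mod M n : lmodType R := free_mod (syzygy M n).

Definition res_diff M n : {linear res_mod M n.+1 -> res_mod M n} :=
  (\val : {linear submod (lin_ker (@augment (syzygy M n))) -> res_mod M n})
    \o @augment (syzygy M n.+1).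

Definition exact_at M N P (f : M -> N) (g : N -> P) : Prop :=
  forall n, g n = 0 <-> exists m, f m = n.

Lemma res_exact0 M : exact_at (res_diff M 0) (@augment M).
Proof.
move=> c; split=> [c0|[d <-]]; last exact/eqP/(submod_valP (augment d)).
have kc : c \in lin_ker (@augment M) by apply/eqP.
have [d dc] := @augment_surj (syzygy M 1) (Submod kc).
by exists d; rewrite /= dc.
Qed.

Lemma res_exact M n : exact_at (res_diff M n.+1) (res_diff M n).
Proof.
move=> c; split=> [c0|[d <-]].
  have kc : c \in lin_ker (@augment (syzygy M n.+1)) by apply/eqP/val_inj.
  have [d dc] := @augment_surj (syzygy M n.+2) (Submod kc).
  by exists d; rewrite /= dc.
have /eqP e0 := submod_valP (augment d).
by rewrite /= e0.
Qed.

(* The [i]th cohomology of [Hom (res_mod M -) N]. *)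
Definition Ext (i : nat) M N : lmodType R :=
  if i is j.+1 then
    homology (Hom_pre N (res_diff M j)) (Hom_pre N (res_diff M j.+1))
  else
    homology (\0 : {linear Hom (res_mod M 0) N -> Hom (res_mod M 0) N})
      (Hom_pre N (res_diff M 0)).

Definition zero_mod M : Prop := forall m : M, m = 0.

Definition finite_mod M : Prop :=
  exists (n : nat) (v : 'I_n -> M),
    forall m, exists r : 'I_n -> R, m = \sum_(i < n) r i *: v i.

Definition semidualizing C : Prop :=
  [/\ finite_mod C,
      bijective (@homothety C) &
      forall i, (0 < i)%N -> zero_mod (Ext i C C)].

Definition exact_zero_divisors M (x y : R) : Prop :=
  [/\ range (fun m : M => x *: m) <> [set 0],
      range (fun m : M => x *: m) <> setT,
      exact_at ( *:%R x : M -> M) ( *:%R y : M -> M) &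
      exact_at ( *:%R y : M -> M) ( *:%R x : M -> M)].

Definition G_projective C M : Prop :=
  [/\ finite_mod M,
      bijective (@biduality M C),
      forall i, (0 < i)%N -> zero_mod (Ext i M C) &
      forall i, (0 < i)%N -> zero_mod (Ext i (Hom M C) C)].

End Hom.

Definition noetherian (R : comPzRingType) : Prop :=
  forall I : submodClosed R^o, finite_mod (submod I).

(* [R/xR] as an [R]-module; [xR] is the image of multiplication by [x]. *)
Definition quot_by (R : comPzRingType) (x : R) : lmodType R :=
  quotmod (lin_im ( *:%R x : {linear R^o -> R^o})).

(* Main.v *)
(* Write K_x for the kernel of multiplication by x on B, where B is R or C.
   Exactness gives short exact sequences 0 -> K_y -> B -> K_x -> 0 and
   0 -> K_x -> B -> K_y -> 0.  As Ext^i(B, C) = 0 for i > 0, dimension shifting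
   reduces Ext^i(K_x, C) = 0 = Ext^i(K_y, C) to the case i = 1, that is, to
   extending homomorphisms K_x -> C and K_y -> C to B.  For B = R this is the
   exactness of x, y on C; for B = C, a map K_x -> C composed with y : C -> K_x
   is multiplication by some s with s x = 0, so s = y t and the map is
   multiplication by t.  This covers both Ext conditions, because R/x is K_x in
   R and Hom(R/x, C) is K_x in C; the same computation identifies
   Hom(Hom(R/x, C), C) with R/x.
   Dimension shifting is done on the standard resolution: Ext^(n+1)(M, N)
   vanishes iff every map from the (n+1)st syzygy of M to N extends to the free
   module containing it, and syzygies are compared up to projective summands. *)
From HB Require Import structures.
Require Import Defs.
From mathcomp Require Import all_boot all_algebra.
From mathcomp Require Import finmap.
From mathcomp Require Import boolp classical_sets functions cardinality fsbigop.

Set Implicit Arguments.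
Unset Strict Implicit.
Unset Printing Implicit Defensive.

Import GRing.Theory.
Local Open Scope classical_set_scope.
Local Open Scope ring_scope.

(** * Linear maps built from relations, surjections and kernels *)

Section LinearMaps.
Variable R : comPzRingType.
Implicit Types M N P K : lmodType R.

Definition lin_of M N (f : M -> N) (lf : linear f) : {linear M -> N} :=
  hom_fun (Submod (asboolT lf : f \in @is_hom R M N)).

Lemma lin_ofE M N (f : M -> N) (lf : linear f) m : lin_of lf m = f m.
Proof. by []. Qed.

Definition surj M N (f : M -> N) := forall n, exists m, f m = n.

(** As [T] is closed under linear combinations, two values at one [m] differ by a value at 0; so
    values are unique, and the chosen function is linear. *)
Lemma lin_of_rel M N (T : M -> N -> Prop) :
    (forall m, exists n, T m n) ->
    (forall a m n m' n', T m n -> T m' n' -> T (a *: m + m') (a *: n + n')) ->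
    (forall n, T 0 n -> n = 0) ->
  exists f : {linear M -> N}, forall m, T m (f m).
Proof.
move=> tot lin T0; have [f fT] := choice tot.
have uniqT m n n' : T m n -> T m n' -> n = n'.
  move=> Tn Tn'; have := lin (-1) _ _ _ _ Tn' Tn.
  by rewrite !scaleN1r addNr => /T0; rewrite addrC => /subr0_eq.
have lf : linear f by
  move=> a u v; apply: uniqT (fT _) (lin _ _ _ _ _ (fT _) (fT _)).
by exists (lin_of lf).
Qed.

Lemma factor_surj M K N (p : {linear M -> K}) (f : {linear M -> N}) :
    surj p -> (forall m, p m = 0 -> f m = 0) ->
  exists g : {linear K -> N}, forall m, g (p m) = f m.
Proof.
move=> sp kf.
have [|||g gT] := @lin_of_rel K N (fun k n => exists2 m, p m = k & f m = n).
- by move=> k; have [m] := sp k; exists (f m), m.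
- move=> a _ _ _ _ [m <- <-] [m' <- <-].
  by exists (a *: m + m'); rewrite linearP.
- by move=> _ [m /kf fm <-].
exists g => m; have [m' pm' <-] := gT (p m).
by apply/subr0_eq; rewrite -linearB kf // linearB pm' subrr.
Qed.

Definition kval M N (f : {linear M -> N}) (k : submod (lin_ker f)) : M :=
  submod_val k.
Arguments kval {M N} f k : simpl never.

Fact kval_is_linear M N (f : {linear M -> N}) : linear (kval f).
Proof. exact: (linearP (\val : {linear submod (lin_ker f) -> M})). Qed.

HB.instance Definition _ M N (f : {linear M -> N}) :=
  GRing.isLinear.Build R (submod (lin_ker f)) M *:%R (kval f)
    (@kval_is_linear M N f).

Lemma kval_inj M N (f : {linear M -> N}) : injective (kval f).
Proof. exact: val_inj. Qed.

Lemma kvalK M N (f : {linear M -> N}) (k : submod (lin_ker f)) :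
  f (kval f k) = 0.
Proof. exact/eqP/(submod_valP k). Qed.

Lemma ker_of M N (f : {linear M -> N}) m :
  f m = 0 -> exists k, kval f k = m.
Proof. by move=> /eqP fm; exists (@Submod _ _ (lin_ker f) m fm). Qed.

Lemma factor_ker M N P (g : {linear N -> P}) (f : {linear M -> N}) :
    (forall m, g (f m) = 0) ->
  exists f' : {linear M -> submod (lin_ker g)}, forall m, kval g (f' m) = f m.
Proof.
move=> gf; apply: (@lin_of_rel _ _ (fun m k => kval g k = f m)).
- by move=> m; exact: ker_of.
- by move=> a m n m' n' e e'; rewrite kval_is_linear e e' linearP.
- by move=> n; rewrite linear0 => n0; apply: kval_inj; rewrite n0 linear0.
Qed.

(** For [p] surjective: the connecting map from Hom(ker p, N) to Ext^1(K, N) is zero. If moreover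
    [P] is projective: Ext^1(K, N) = 0. *)
Definition extends P K (p : {linear P -> K}) N :=
  forall f : {linear submod (lin_ker p) -> N},
  exists g : {linear P -> N}, forall k, g (kval p k) = f k.

Definition projective P :=
  forall M N (p : {linear M -> N}) (f : {linear P -> N}), surj p ->
  exists g : {linear P -> M}, forall m, p (g m) = f m.

Lemma kvalZ M N (f : {linear M -> N}) a k : kval f (a *: k) = a *: kval f k.
Proof. exact: linearZZ. Qed.

End LinearMaps.

Arguments kval {R M N} f k : simpl never.

(** * Free modules: basis, universal property, projectivity *)

Section FreeModule.
Variable R : comPzRingType.

Section Ext.
Variables (X : choiceType) (M : lmodType R) (f : X -> M).
Implicit Type c d : free_mod R X.

Definition free_ext c : M := \sum_(x \in [set: X]) coef c x *: f x.

Lemma free_extE (A : set X) c : finite_set A ->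
    [set x | coef c x != 0] `<=` A ->
  free_ext c = \sum_(x <- fset_set A) coef c x *: f x.
Proof.
move=> finA cA; rewrite -fsbig_finite //; apply/esym/fsbig_widen => // x [_ Ax].
rewrite /preimage /=; have [->|/cA //] := eqVneq (coef c x) 0.
by rewrite scale0r.
Qed.

Lemma free_ext_linear : linear free_ext.
Proof.
move=> a c d; pose A := [set x | coef c x != 0] `|` [set x | coef d x != 0].
have finA : finite_set A by rewrite finite_setU; split; exact: coef_fin.
rewrite !(@free_extE A) //; first 1 last.
- by move=> x; right.
- by move=> x; left.
- move=> x; rewrite /mkset; apply: contraNP.
  move=> /not_orP[/negP/negPn/eqP c0 /negP/negPn/eqP d0].
  by rewrite coefP c0 d0 mulr0 addr0.
rewrite scaler_sumr -big_split; apply: eq_bigr => x _.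
by rewrite coefP scalerDl scalerA.
Qed.

End Ext.

Section Delta.
Variable X : choiceType.

Fact delta_fin (x : X) :
  (fun z => if z == x then 1 else 0 : R^o) \in @fin_supp R X.
Proof.
apply/asboolP; apply: (sub_finite_set _ (finite_set1 x)) => z /=.
by case: (eqVneq z x) => // _ /eqP.
Qed.

Definition delta (x : X) : free_mod R X := Submod (delta_fin x).

Lemma coef_delta x z : coef (delta x) z = (z == x)%:R.
Proof. by rewrite /coef /=; case: eqP. Qed.

Lemma free_ext_delta (M : lmodType R) (f : X -> M) x :
  free_ext f (delta x) = f x.
Proof.
rewrite (@free_extE _ _ _ [set x]) ?fset_set1 ?big_seq_fset1 //.
  by rewrite coef_delta eqxx scale1r.
by move=> z; rewrite /mkset coef_delta; case: (eqVneq z x) => // _ /eqP.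
Qed.

Lemma free_ext_delta_id c : free_ext delta c = c.
Proof.
apply: val_inj; apply/funext => z; rewrite -[LHS]/(coef _ z) -[RHS]/(coef c z).
(* Making the coordinate at [z] a linear map lets it pass through the sum. *)
pose coefz :=
  lin_of (fun a (c d : free_mod R X) => coefP a c d z : _ = _ :> R^o).
rewrite (@free_extE _ _ _ [set x | coef c x != 0]) //; last exact: coef_fin.
rewrite -[coef _ z]/(coefz _) linear_sum.
have coefz_delta x : coefz (delta x) = (z == x)%:R by exact: coef_delta.
under eq_bigr => x _ do rewrite linearZZ coefz_delta.
have [cz|cz] := eqVneq (coef c z) 0.
  rewrite cz big1 // => x _.
  by case: eqVneq => [<-|_]; rewrite ?cz ?scale0r ?scaler0.
have zA : z \in fset_set [set x | coef c x != 0].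
  by rewrite in_fset_set ?mem_set //; exact: coef_fin.
rewrite (bigD1_seq z) //= big1 ?addr0 ?eqxx => [|x /negPf zx].
  by exact: mulr1.
by rewrite eq_sym zx scaler0.
Qed.

Lemma free_lin_eq (M : lmodType R) (g h : {linear free_mod R X -> M}) :
  (forall x, g (delta x) = h (delta x)) -> g =1 h.
Proof.
move=> gh c; rewrite -(free_ext_delta_id c).
rewrite (@free_extE _ _ _ [set x | coef c x != 0]) //; last exact: coef_fin.
rewrite !linear_sum; apply: eq_bigr => x _; by rewrite !linearZZ gh.
Qed.

Lemma free_lift (M : lmodType R) (f : X -> M) :
  exists h : {linear free_mod R X -> M}, forall x, h (delta x) = f x.
Proof. by exists (lin_of (free_ext_linear f)) => x; exact: free_ext_delta. Qed.

Lemma free_projective : projective (free_mod R X).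
Proof.
move=> M N p f sp; have [s ps] := choice (fun x => sp (f (delta x))).
have [h hE] := free_lift s; exists h.
by apply: (@free_lin_eq N (p \o h) f) => x /=; rewrite hE ps.
Qed.

End Delta.

Lemma augment_delta (M : lmodType R) (m : M) : augment (delta m) = m.
Proof. exact: (free_ext_delta id). Qed.

End FreeModule.

(** * Retracts up to projectives and comparison of projective presentations *)

Section StableRetracts.
Variable R : comPzRingType.
Implicit Types B K M N P Q X Y Z : lmodType R.

(* [X] is a direct summand of [Y] plus a projective module. *)
Definition stable_retract X Y :=
  exists P (u : {linear X -> Y}) (v : {linear Y -> X})
         (a : {linear X -> P}) (b : {linear P -> X}),
    projective P /\ forall m, v (u m) + b (a m) = m.

Lemma split_retract X X' Y (i : {linear X -> X'}) (j : {linear X' -> X}) :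
  (forall m, j (i m) = m) -> stable_retract X' Y -> stable_retract X Y.
Proof.
move=> ji [P [u [v [a [b [pP e]]]]]].
exists P, (u \o i), (j \o v), (a \o i), (j \o b); split=> // m.
by rewrite /= -linearD e.
Qed.

Lemma stable_retract_refl X : stable_retract X X.
Proof.
exists (free_mod R X), idfun, idfun, \0, \0; split=> [|m].
  exact: free_projective.
by rewrite /= addr0.
Qed.

Section Lift.
Variables (P X Q Y : lmodType R) (p : {linear P -> X}) (q : {linear Q -> Y}).
Hypotheses (projP : projective P) (projQ : projective Q).
Hypotheses (surjp : surj p) (surjq : surj q) (XY : stable_retract X Y).

(** Lift the maps [u0], [v0] and [b] to the presentations. The identity of [P] minus the lifted
    composites lands in ker p, which gives [s]; on ker p the composite through the projective
    summand vanishes. *)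
Lemma retract_lift :
  exists (u : {linear P -> Q})
    (v : {linear submod (lin_ker q) -> submod (lin_ker p)})
    (u' : {linear submod (lin_ker p) -> submod (lin_ker q)})
    (s : {linear P -> submod (lin_ker p)}),
    (forall k, kval q (u' k) = u (kval p k)) /\
    (forall k, v (u' k) + s (kval p k) = k).
Proof.
have [S [u0 [v0 [a [b [projS e]]]]]] := XY.
have [u uE] := projP (u0 \o p) surjq.
have [v vE] := projQ (v0 \o q) surjp.
have [b' bE] := projS _ _ p b surjp.
have [|u' u'E] := @factor_ker _ _ _ _ q (u \o kval p).
  by move=> k; rewrite /= uE /= kvalK linear0.
have [|v' v'E] := @factor_ker _ _ _ _ p (v \o kval q).
  by move=> k; rewrite /= vE /= kvalK linear0.
have [|s sE] := @factor_ker _ _ _ _ p (idfun \- ((v \o u) \+ (b' \o (a \o p)))).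
  move=> c; rewrite linearB linearD /= vE /= uE bE /= -[in X in X - _](e (p c)).
  by rewrite subrr.
exists u, v', u', s; split=> // k; apply: kval_inj.
by rewrite linearD /= v'E sE /= u'E kvalK !linear0 addr0 addrC subrK.
Qed.

(** As [s] is defined on all of [P], only the part of [f] through [v \o u'] has to be extended, and
    [Q] provides that. *)
Lemma extends_retract N : extends q N -> extends p N.
Proof.
move=> qN f; have [u [v [u' [s [uE vE]]]]] := retract_lift.
have [g gE] := qN (f \o v); exists ((g \o u) \+ (f \o s)) => k.
by rewrite /= -uE gE /= -linearD vE.
Qed.

Lemma ker_retract : stable_retract (submod (lin_ker p)) (submod (lin_ker q)).
Proof.
have [u [v [u' [s [uE vE]]]]] := retract_lift.
by exists P, u', v, (kval p), s.
Qed.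

End Lift.

Lemma surj_augment M : surj (@augment R M).
Proof. exact: augment_surj. Qed.

Definition ext1 M N := extends (@augment R M) N.

Lemma ext1_retract X Y N : stable_retract X Y -> ext1 Y N -> ext1 X N.
Proof.
move=> XY; apply: (extends_retract _ _ _ _ XY);
  by [exact: free_projective | exact: surj_augment].
Qed.

Lemma same_ker P X Y (p : {linear P -> X}) (q : {linear P -> Y}) :
    (forall m, p m = 0 -> q m = 0) ->
  exists i : {linear submod (lin_ker p) -> submod (lin_ker q)},
    forall k, kval q (i k) = kval p k.
Proof. by move=> pq; apply: factor_ker => k; rewrite pq ?kvalK. Qed.

Lemma same_ker_retract P X Y (p : {linear P -> X}) (q : {linear P -> Y}) :
    (forall m, p m = 0 <-> q m = 0) ->
  stable_retract (submod (lin_ker p)) (submod (lin_ker q)).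
Proof.
move=> pq; have [i iE] := same_ker (fun m => proj1 (pq m)).
have [j jE] := same_ker (fun m => proj2 (pq m)).
apply: (@split_retract _ _ _ i j _ (stable_retract_refl _)) => k.
by apply: kval_inj; rewrite jE iE.
Qed.

Lemma extends_same_ker P X Y (p : {linear P -> X}) (q : {linear P -> Y}) N :
  (forall m, p m = 0 <-> q m = 0) -> extends p N -> extends q N.
Proof.
move=> pq pN f; have [i iE] := same_ker (fun m => proj1 (pq m)).
have [j jE] := same_ker (fun m => proj2 (pq m)).
have [g gE] := pN (f \o i); exists g => k; rewrite -jE gE /=.
by congr (f _); apply: kval_inj; rewrite iE jE.
Qed.

(** First extend from ker p to [P]. The error vanishes on ker p, so it descends to ker g, extends to
    [B] and is pulled back along [p]. *)
Lemma extends_comp P B K (p : {linear P -> B}) (g : {linear B -> K}) N :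
  surj p -> extends p N -> extends g N -> extends (g \o p) N.
Proof.
move=> sp pN gN f.
have [|i iE] := @same_ker _ _ _ p (g \o p).
  by move=> m pm; rewrite /= pm linear0.
have [h hE] := pN (f \o i).
have [|t tE] := @factor_ker _ _ _ _ g (p \o kval (g \o p)).
  by move=> m; exact: (kvalK m).
have st : surj t.
  move=> k; have [m pm] := sp (kval g k).
  have [|m' m'E] := @ker_of _ _ _ (g \o p) m; first by rewrite /= pm kvalK.
  by exists m'; apply: kval_inj; rewrite tE /= m'E.
have [|a aE] := @factor_surj _ _ _ N t (f \- (h \o kval (g \o p))) st.
  move=> m tm; have [|m' m'E] := @ker_of _ _ _ p (kval (g \o p) m).
    by have := tE m; rewrite tm linear0.
  apply/eqP; rewrite /= subr_eq0 -m'E hE /=; apply/eqP; congr (f _).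
  by apply: kval_inj; rewrite iE m'E.
have [b bE] := gN a; exists (h \+ (b \o p)) => k.
by rewrite /= -[p _]tE bE aE /= addrC subrK.
Qed.

(** The free module over [B] also presents [K] through [g]; this presentation is compared with the
    standard one of [K]. *)
Lemma ext1_quotient B K N (g : {linear B -> K}) :
  surj g -> ext1 B N -> extends g N -> ext1 K N.
Proof.
move=> sg BN gN.
apply: (extends_retract _ _ _ _ (stable_retract_refl K))
  (extends_comp (@surj_augment B) BN gN).
- exact: free_projective.
- exact: free_projective.
- exact: surj_augment.
- by move=> k; have [b <-] := sg k; have [c <-] := surj_augment b; exists c.
Qed.

(** * Syzygies of short exact sequences and dimension shifting *)

Lemma ker_split P Q (h : {linear P -> Q}) : projective Q -> surj h ->
  exists r : {linear P -> submod (lin_ker h)}, forall k, r (kval h k) = k.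
Proof.
move=> pQ sh; have [s sE] := pQ _ _ h idfun sh.
have [|r rE] := @factor_ker _ _ _ _ h (idfun \- (s \o h)).
  by move=> m; rewrite linearB /= sE subrr.
by exists r => k; apply: kval_inj; rewrite rE /= kvalK linear0 subr0.
Qed.

Lemma ker_projective P Q (h : {linear P -> Q}) :
  projective P -> projective Q -> surj h -> projective (submod (lin_ker h)).
Proof.
move=> pP pQ sh M N p f sp; have [r rE] := ker_split pQ sh.
have [g gE] := pP _ _ p (f \o r) sp.
by exists (g \o kval h) => k; rewrite /= gE /= rE.
Qed.

Lemma snake B K Z (g : {linear B -> K}) :
    surj g -> stable_retract (submod (lin_ker g)) Z ->
  exists g' : {linear syzygy B 1 -> syzygy K 1},
    [/\ surj g', stable_retract (submod (lin_ker g')) (syzygy Z 1) &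
        forall N, ext1 Z N -> extends g' N].
Proof.
move=> sg gZ.
(* The kernel of [g'] is also that of the restriction [t : ker h -> ker g] of
   the augmentation.  As [ker h] is projective, it is a syzygy of [ker g]; [t]
   is surjective because [delta b - delta 0] is in [ker h] if [g b = 0]. *)
have [h hE] := free_lift (fun b => delta R (g b)).
have hg c : augment (h c) = g (augment c).
  apply: (@free_lin_eq _ _ _ (@augment R K \o h) (g \o @augment R B)) => b.
  by rewrite /= hE !augment_delta.
have sh : surj h.
  (* Since [h] sends basis vectors to basis vectors, a set-theoretic section of [g] suffices. *)
  have [s sE] := choice sg; have [s' s'E] := free_lift (fun k => delta R (s k)).
  move=> c; exists (s' c); apply: (@free_lin_eq _ _ _ (h \o s') idfun) => k.
  by rewrite /= s'E hE sE.
pose z b := delta R b - delta R 0 : free_mod R B.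
have zE b : augment (z b) = b by rewrite linearB /= !augment_delta subr0.
have hz b : g b = 0 -> h (z b) = 0.
  by move=> gb; rewrite linearB /= !hE gb linear0 subrr.
have [|g' g'E] := @factor_ker _ _ _ _ (@augment R K) (h \o kval (@augment R B)).
  by move=> k; rewrite /= hg kvalK linear0.
have [|t tE] := @factor_ker _ _ _ _ g (@augment R B \o kval h).
  by move=> k; rewrite /= -hg kvalK linear0.
have st : surj t.
  move=> a; have [|k kE] := @ker_of _ _ _ h (z (kval g a)).
    by rewrite hz ?kvalK.
  by exists k; apply: kval_inj; rewrite tE /= kE zE.
have [|i1 i1E] := @factor_ker _ _ _ _ h (kval (@augment R B) \o kval g').
  by move=> k; have := g'E (kval g' k); rewrite kvalK linear0.
have [|i iE] := @factor_ker _ _ _ _ t i1.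
  by move=> k; apply: kval_inj; rewrite tE linear0 /= i1E /= kvalK.
have [|j1 j1E] := @factor_ker _ _ _ _ (@augment R B) (kval h \o kval t).
  by move=> k; have := tE (kval t k); rewrite kvalK linear0.
have [|j jE] := @factor_ker _ _ _ _ g' j1.
  by move=> k; apply: kval_inj; rewrite g'E linear0 /= j1E /= kvalK.
have ji k : j (i k) = k.
  by apply: kval_inj; apply: kval_inj; rewrite jE j1E /= iE i1E.
have pB := @free_projective R B; have pK := @free_projective R K.
have pZ := @free_projective R Z; have ph := ker_projective pB pK sh.
exists g'; split.
(* The preimage [c] need not be a syzygy; subtracting [z (augment c)] kills its augmentation without
   changing its image under [h]. *)
- move=> k; have [c hc] := sh (kval _ k).
  have gc : g (augment c) = 0 by rewrite -hg hc kvalK.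
  have [|b bE] := @ker_of _ _ _ (@augment R B) (c - z (augment c)).
    by rewrite linearB /= zE subrr.
  by exists b; apply: kval_inj; rewrite g'E /= bE linearB hz // subr0.
- apply: split_retract ji _; apply: ker_retract => //; exact: surj_augment.
(* [t] presents ker g by the projective ker h, so [f \o j] extends to ker h; the retraction [r]
   carries this to the syzygy of [B]. *)
- move=> N ZN f; have tN : extends t N.
    by apply: (extends_retract _ _ _ _ gZ) ZN => //; exact: surj_augment.
  have [e eE] := tN (f \o j); have [r rE] := ker_split pK sh.
  exists (e \o (r \o kval (@augment R B))) => k /=.
  have -> : kval (@augment R B) (kval g' k) = kval h (kval t (i k)).
    by rewrite iE i1E.
  by rewrite rE eE /= ji.
Qed.

Lemma snake_iter B K Z (g : {linear B -> K}) n :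
    surj g -> stable_retract (submod (lin_ker g)) Z ->
  exists g' : {linear syzygy B n -> syzygy K n},
    surj g' /\ stable_retract (submod (lin_ker g')) (syzygy Z n).
Proof.
move=> sg gZ; elim: n => [|n [g1 [sg1 g1Z]]]; first by exists g.
by have [g2 [sg2 g2Z _]] := snake sg1 g1Z; exists g2.
Qed.

(** This is the exact piece Ext^(n+1)(ker g, N) -> Ext^(n+2)(K, N) -> Ext^(n+2)(B, N), with [Z]
    controlling ker g up to projectives. *)
Lemma dimension_shift B K Z N (g : {linear B -> K}) n :
    surj g -> stable_retract (submod (lin_ker g)) Z ->
  ext1 (syzygy Z n) N -> ext1 (syzygy B n.+1) N -> ext1 (syzygy K n.+1) N.
Proof.
move=> sg gZ ZN BN; have [g1 [sg1 g1Z]] := snake_iter n sg gZ.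
have [g2 [sg2 _ g2N]] := snake sg1 g1Z.
exact: ext1_quotient sg2 BN (g2N N ZN).
Qed.

Lemma syzygy_projective P n : projective P -> projective (syzygy P n).
Proof.
move=> pP; elim: n => //= n IHn.
by apply: ker_projective => //; [exact: free_projective|exact: surj_augment].
Qed.

Lemma syzygy_retract X Y n :
  stable_retract X Y -> stable_retract (syzygy X n) (syzygy Y n).
Proof.
move=> XY; elim: n => //= n IHn.
by apply: ker_retract IHn;
  by [exact: free_projective | exact: surj_augment].
Qed.

Lemma projective_ext1 P N : projective P -> ext1 P N.
Proof.
move=> pP f; have [r rE] := ker_split pP (@surj_augment P).
by exists (f \o r) => k; rewrite /= rE.
Qed.

(** * Vanishing of Ext in terms of syzygies *)

Lemma quotmod_zero M (S : submodClosed M) :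
  zero_mod (quotmod S) <-> forall m, m \in S.
Proof.
split=> [S0 m|S1 q].
  have /quotmod_piP : quotmod_pi S m = quotmod_pi S 0.
    by rewrite [LHS]S0 [RHS]S0.
  by rewrite subr0.
rewrite -(quotmod_reprK q) -(linear0 (@quotmod_pi R M S)).
by apply/quotmod_piP; rewrite subr0.
Qed.

Lemma Ext_zeroP M N n : zero_mod (Ext n.+1 M N) <-> ext1 (syzygy M n) N.
Proof.
rewrite quotmod_zero; split=> [E f|E h].
  pose h := hom_of (f \o @augment R (syzygy M n.+1)).
  have [|k kE] := @ker_of _ _ _ (@Hom_pre R _ _ N (res_diff M n.+1)) h.
    apply: hom_ext => c; have e := kvalK (@augment R (syzygy M n.+2) c).
    exact: etrans (congr1 f e) (linear0 f).
  have /asboolP[g _ gE] := E k.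
  exists (hom_fun g) => m; have [c <-] := surj_augment m.
  by have /(congr1 (fun h => hom_fun h c)) := etrans gE kE.
apply/asboolP; pose h' := kval _ h.
have hd : forall c, hom_fun h' (res_diff M n.+1 c) = 0.
  by move=> c; have /(congr1 (fun h => hom_fun h c)) := kvalK h.
have [|f fE] := factor_surj (@surj_augment (syzygy M n.+1)) (f := hom_fun h').
  move=> c c0; have [|d <-] := (@res_exact R M n c).1; last exact: hd.
  exact: etrans (congr1 (kval (@augment R (syzygy M n))) c0) (linear0 _).
have [g gE] := E f; exists (hom_of g) => //.
by apply: hom_ext => c; rewrite -[RHS]fE -gE.
Qed.

End StableRetracts.

(** * Kernels of multiplication by exact zero-divisors *)

Section Multiplication.
Variable R : comPzRingType.
Implicit Types B C N : lmodType R.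

Definition mul B (x : R) : {linear B -> B} := *:%R x.

Lemma mulE B x (b : B) : mul B x b = x *: b.
Proof. by []. Qed.

Lemma scale_linear B (b : B) : linear (fun r : R^o => r *: b).
Proof. by move=> a r s; rewrite scalerDl scalerA. Qed.

(** Multiplication by [y] maps [B] onto ker x with kernel ker y, so each dimension shift exchanges
    [x] and [y]; hence the induction carries the extension property for both. *)
Lemma ext1_ker_mul B N x y n :
    exact_at (mul B x) (mul B y) -> exact_at (mul B y) (mul B x) ->
    extends (mul B x) N -> extends (mul B y) N ->
    (forall j, ext1 (syzygy B j) N) ->
  ext1 (syzygy (submod (lin_ker (mul B x))) n) N.
Proof.
move=> + + + + BN; elim: n x y => [|n IHn] x y exy eyx xN yN.
all: have [|p pE] := @factor_ker _ _ _ _ (mul B x) (mul B y);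
  first by move=> b; apply/eyx; exists b.
all: have sp : surj p by
  move=> k; have /eyx[b bk] := kvalK k; exists b; apply: kval_inj; rewrite pE.
all: have pker b : p b = 0 <-> mul B y b = 0 by
  rewrite -pE; split=> [->|pb0]; [|apply: kval_inj];
  rewrite ?pb0 linear0.
  apply: (ext1_quotient sp (BN 0)); apply: extends_same_ker yN => b.
  exact: iff_sym.
apply: dimension_shift sp (same_ker_retract pker) _ (BN n.+1).
exact: IHn eyx exy yN xN.
Qed.

(** In [R], ker x is generated by [y]. The value of [f] at [y] is killed by [x], so it is [y *: c]
    for some [c], and sending 1 to [c] extends [f]. *)
Lemma extends_mul_regular C x y :
    exact_at (mul R^o y) (mul R^o x) -> exact_at (mul C y) (mul C x) ->
  extends (mul R^o x) C.
Proof.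
move=> eR eC f; have [|k kE] := @ker_of _ _ _ (mul R^o x) y.
  by apply/eR; exists 1; exact: mulr1.
have [|c cE] := (eC (f k)).1.
  rewrite mulE -linearZZ (_ : x *: k = 0) ?linear0 //; apply: kval_inj.
  by rewrite kvalZ kE linear0; apply/eR; exists 1; exact: mulr1.
exists (lin_of (scale_linear c)) => m; rewrite lin_ofE.
have /eR[r rE] := kvalK m.
have -> : m = r *: k by apply: kval_inj; rewrite kvalZ kE -rE; exact: mulrC.
rewrite [RHS]linearZZ -cE mulE scalerA; congr (_ *: _).
by rewrite [LHS]kvalZ kE.
Qed.

Section Semidualizing.
Variable C : lmodType R.
Hypothesis bijC : bijective (@homothety R C).

Lemma homothety_surj (f : {linear C -> C}) :
  exists r : R, forall c, f c = r *: c.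
Proof.
have [g _ gK] := bijC; exists (g (hom_of f)) => c.
by have := congr1 (fun h => hom_fun h c) (gK (hom_of f)).
Qed.

Lemma homothety_inj (r : R) : (forall c : C, r *: c = 0) -> r = 0.
Proof.
move=> r0; apply: (bij_inj bijC); apply: hom_ext => c.
exact: etrans (r0 c) (esym (scale0r c)).
Qed.

(** Besides extending maps from ker x to [C], this serves the surjectivity of biduality, where the
    scalar [t] itself is needed. *)
Lemma ker_mul_hom x y (f : {linear submod (lin_ker (mul C x)) -> C}) :
    exact_at (mul R^o y) (mul R^o x) ->
    exact_at (mul C x) (mul C y) -> exact_at (mul C y) (mul C x) ->
  exists t : R, forall k, f k = t *: kval (mul C x) k.
Proof.
move=> eR exy eyx.
have [|p pE] := @factor_ker _ _ _ _ (mul C x) (mul C y).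
  by move=> c; apply/eyx; exists c.
have [s sE] := homothety_surj (f \o p).
(* [x * s] annihilates [C] because [p] kills xC, and homotheties of [C] are faithful. *)
have /eR[t tE] : mul R^o x s = 0.
  apply: homothety_inj => c.
  rewrite -[_ *: c]/((x * s) *: c) mulrC -scalerA -sE /=.
  rewrite (_ : p _ = 0) ?linear0 //; apply: kval_inj.
  by rewrite pE linear0; apply/exy; exists c.
exists t => k; have /eyx[c cE] := kvalK k.
have -> : k = p c by apply: kval_inj; rewrite pE.
by rewrite [LHS]sE pE mulE scalerA -tE mulrC.
Qed.

Lemma extends_mul_semidualizing x y :
    exact_at (mul R^o y) (mul R^o x) ->
    exact_at (mul C x) (mul C y) -> exact_at (mul C y) (mul C x) ->
  extends (mul C x) C.
Proof.
move=> eR exy eyx f; have [t tE] := ker_mul_hom f eR exy eyx.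
by exists (mul C t) => k; rewrite tE.
Qed.

End Semidualizing.

(** * The module R/xR, its dual and its bidual *)

Section Quotient.
Variable x : R.

Definition quot_pi (r : R) : quot_by x := quotmod_pi _ (r : R^o).

Lemma quot_pi_surj q : exists r, quot_pi r = q.
Proof. by exists (quotmod_repr q); exact: quotmod_reprK. Qed.

Lemma quot_pi_linear : linear (quot_pi : R^o -> quot_by x).
Proof. by move=> a r s; rewrite /quot_pi linearP. Qed.

Lemma quot_piE r : quot_pi r = r *: quot_pi 1.
Proof.
rewrite -[RHS](linearZZ (lin_of quot_pi_linear)); congr quot_pi.
exact/esym/mulr1.
Qed.

Lemma quot_pi0 r : quot_pi r = 0 <-> exists s, x * s = r.
Proof.
rewrite -[0](linear0 (@quotmod_pi R R^o _)) /quot_pi; split.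
  by move/quotmod_piP; rewrite subr0 => /asboolP[s _ <-]; exists s.
by case=> s <-; apply/quotmod_piP; rewrite subr0; apply/asboolP; exists s.
Qed.

Lemma finite_quot : finite_mod (quot_by x).
Proof.
exists 1, (fun _ => quot_pi 1) => q; have [r <-] := quot_pi_surj q.
by exists (fun _ => r); rewrite big_ord1 quot_piE.
Qed.

Lemma quot_hom C (c : C) : x *: c = 0 ->
  exists h : {linear quot_by x -> C}, forall r, h (quot_pi r) = r *: c.
Proof.
move=> xc.
apply: (factor_surj (p := lin_of quot_pi_linear)
  (f := lin_of (scale_linear c))) => [q|r].
  exact: quot_pi_surj.
by move/quot_pi0 => [s <-]; rewrite lin_ofE mulrC -scalerA xc scaler0.
Qed.

Lemma hom_quotE C (h : Defs.Hom (quot_by x) C) r :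
  hom_fun h (quot_pi r) = r *: hom_fun h (quot_pi 1).
Proof.
by rewrite quot_piE linearZZ.
Qed.

(** Both modules are cyclic with annihilator xR; the class of 1 corresponds to [y]. *)
Lemma quot_ker_retract y :
    exact_at (mul R^o x) (mul R^o y) -> exact_at (mul R^o y) (mul R^o x) ->
  stable_retract (quot_by x) (submod (lin_ker (mul R^o x))).
Proof.
move=> exy eyx; have [|k kE] := @ker_of _ _ _ (mul R^o x) y.
  by apply/eyx; exists 1; exact: mulr1.
have xk : x *: k = 0.
  apply: kval_inj; rewrite kvalZ kE linear0.
  by apply/eyx; exists 1; exact: mulr1.
have [i iE] := quot_hom xk.
(* The inverse sends [r *: k] to the class of [r], well defined because the annihilator of [y] is
   xR. *)
have [|||j jE] := @lin_of_rel _ (submod (lin_ker (mul R^o x))) (quot_by x)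
   (fun m q => exists2 r, r *: k = m & quot_pi r = q).
- move=> m; have /eyx[r rE] := kvalK m; exists (quot_pi r), r => //.
  by apply: kval_inj; rewrite kvalZ kE -rE; exact: mulrC.
- move=> a _ _ _ _ [r <- <-] [s <- <-]; exists (a * r + s).
    by rewrite scalerDl scalerA.
  exact: quot_pi_linear.
- move=> _ [r rk <-]; apply/quot_pi0.
  have /exy[s sE] : mul R^o y r = 0.
    rewrite -[RHS](linear0 (kval (mul R^o x))) -rk [RHS]kvalZ kE.
    exact: mulrC.
  by exists s.
apply: (@split_retract _ _ _ _ i j _ (stable_retract_refl _)) => q.
have [r <-] := quot_pi_surj q; have [s + <-] := jE (i (quot_pi r)).
rewrite iE => /eqP; rewrite -subr_eq0 -scalerBl => /eqP srk.
apply/subr0_eq; rewrite -[LHS](linearB (lin_of quot_pi_linear)); apply/quot_pi0.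
have /exy[t tE] : mul R^o y (s - r) = 0.
  rewrite -[RHS](linear0 (kval (mul R^o x))) -srk [RHS]kvalZ kE.
  exact: mulrC.
by exists t.
Qed.

(** [j] inverts evaluation at the class of 1, whose image may be any element of [C] killed by
    [x]. *)
Lemma quot_hom_linear C :
  exists j : {linear submod (lin_ker (mul C x)) -> Defs.Hom (quot_by x) C},
    forall k, hom_fun (j k) (quot_pi 1) = kval (mul C x) k.
Proof.
apply: (@lin_of_rel _ _ _ (fun k h => hom_fun h (quot_pi 1) = kval _ k)).
- move=> k; have [h hE] := quot_hom (kvalK k).
  by exists (hom_of h); rewrite hom_ofK hE scale1r.
- by move=> a k h k' h' e e'; rewrite kval_is_linear -e -e'.
- move=> h; rewrite linear0 => h0; apply: hom_ext => q.
  by have [r <-] := quot_pi_surj q; rewrite hom_quotE h0 scaler0.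
Qed.

Lemma hom_quot_ker C (h : Defs.Hom (quot_by x) C) :
  x *: hom_fun h (quot_pi 1) = 0.
Proof.
rewrite -linearZZ (_ : x *: quot_pi 1 = 0) ?linear0 //.
by rewrite -quot_piE; apply/quot_pi0; exists 1; rewrite mulr1.
Qed.

Lemma hom_quot_retract C :
  stable_retract (Defs.Hom (quot_by x) C) (submod (lin_ker (mul C x))).
Proof.
(* Evaluation at the class of 1 is written as a value of [biduality], so that it is linear. *)
have [|i iE] :=
    @factor_ker _ _ _ _ (mul C x) (hom_fun (biduality C (quot_pi 1))).
  exact: hom_quot_ker.
have [j jE] := quot_hom_linear C.
apply: (@split_retract _ _ _ _ i j _ (stable_retract_refl _)) => h.
apply: hom_ext => q; have [r <-] := quot_pi_surj q.
by rewrite hom_quotE jE iE [RHS]hom_quotE.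
Qed.

Lemma biduality_quot C y : bijective (@homothety R C) ->
    exact_at (mul R^o x) (mul R^o y) -> exact_at (mul R^o y) (mul R^o x) ->
    exact_at (mul C x) (mul C y) -> exact_at (mul C y) (mul C x) ->
  bijective (@biduality R (quot_by x) C).
Proof.
move=> bijC Rxy Ryx Cxy Cyx.
(* If every map to [C] kills the class of [r], the maps sending the class of 1 to [y *: c] give r y
   C = 0; so y r = 0 and [r] lies in xR. *)
have inj : injective (@biduality R (quot_by x) C).
  move=> q1 q2 e; apply/subr0_eq; have [r rE] := quot_pi_surj (q1 - q2).
  rewrite -rE; apply/quot_pi0/Rxy; apply: (homothety_inj bijC) => c.
  have [|h hE] := @quot_hom C (y *: c); first by apply/Cyx; exists c.
  rewrite [_ *: c](_ : _ = hom_fun (hom_of h) (quot_pi r)).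
    rewrite rE linearB; apply/eqP; rewrite subr_eq0; apply/eqP.
    exact: (congr1 (fun F => hom_fun F (hom_of h)) e).
  by rewrite hom_ofK hE scalerA mulrC.
(* Pulled back to ker x in [C], [F] is multiplication by some [t], which is evaluation at the class
   of [t]. *)
have sur : surj (@biduality R (quot_by x) C).
  move=> F; have [j jE] := quot_hom_linear C.
  have [t tE] := ker_mul_hom bijC (hom_fun F \o j) Ryx Cxy Cyx.
  exists (quot_pi t); apply: hom_ext => h.
  have [k kE] := ker_of (hom_quot_ker h : mul C x _ = 0).
  have <- : j k = h.
    apply: hom_ext => q; have [r <-] := quot_pi_surj q.
    by rewrite hom_quotE jE kE -hom_quotE.
  by rewrite [RHS]tE -jE; exact: hom_quotE.
have [g gE] := choice sur.
by exists g => // q; apply: inj; rewrite gE.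
Qed.

End Quotient.
End Multiplication.

Theorem proposition3p3 (R : comPzRingType) (C : lmodType R) (x y : R) :
  noetherian R ->
  semidualizing C ->
  exact_zero_divisors R^o x y ->
  exact_zero_divisors C x y ->
  G_projective C (quot_by x).
Proof.
move=> _ [_ bijC extC] [_ _ Rxy Ryx] [_ _ Cxy Cyx].
(* [R] is projective over itself: maps out of it lift by lifting the image of 1. *)
have injR n : ext1 (syzygy R^o n) C.
  apply/projective_ext1/syzygy_projective => M N p f sp.
  have [m mE] := sp (f 1).
  exists (lin_of (scale_linear m)) => r; rewrite lin_ofE linearZZ mE -linearZZ.
  by congr (f _); exact: mulr1.
split.
- exact: finite_quot.
- exact: biduality_quot Rxy Ryx Cxy Cyx.
- case=> // n _; apply/Ext_zeroP.
  apply: ext1_retract (syzygy_retract n (quot_ker_retract Rxy Ryx)) _.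
  apply: (ext1_ker_mul Rxy Ryx _ _ injR).
    exact: extends_mul_regular Ryx Cyx.
  exact: extends_mul_regular Rxy Cxy.
- case=> // n _; apply/Ext_zeroP.
  apply: ext1_retract (syzygy_retract n (hom_quot_retract x C)) _.
  (* The [j]th syzygy corresponds to Ext^(j+1), so vanishing in positive degrees covers every
     [j]. *)
  have acyC j : ext1 (syzygy C j) C by apply/Ext_zeroP/extC.
  apply: (ext1_ker_mul Cxy Cyx _ _ acyC).
    exact: (extends_mul_semidualizing bijC Ryx).
  exact: (extends_mul_semidualizing bijC Rxy).
Qed.
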